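(* Let $\mathbf{n} = (n_1,\dots,n_d)$, let $\mathbf{B} = (B_{\mathbf{i},\mathbf{i}'})$ be a real array indexed by pairs $\mathbf{i},\mathbf{i}' \in [n_1]\times\dots\times[n_d]$, and let $\xi^{(1)} \in \{\pm1\}^{n_1}, \dots, \xi^{(d)} \in \{\pm1\}^{n_d}$ be independent Rademacher vectors. Define $\xi_{\mathbf{i}} = \prod_{l=1}^d \xi^{(l)}_{\mathbf{i}_l}$ for $\mathbf{i} \in [n_1]\times\dots\times[n_d]$, and let $\bar{\boldsymbol{\xi}} = (\bar\xi_{\mathbf{i}})$ be an independent copy of $\boldsymbol{\xi}=(\xi_{\mathbf{i}})$. Let $p \geq 1$ and $\gamma_p \ge 0$. Assume that for all arrays $\mathbf{x} \in \mathbb{R}^{n_1\times\dots\times n_d}$ with $\|\mathbf{x}\|_2 = 1$, \[ \left\| \sum_{\mathbf{i},\mathbf{i}'} B_{\mathbf{i},\mathbf{i}'} x_{\mathbf{i}} x_{\mathbf{i}'} \xi_{\mathbf{i}} \bar\xi_{\mathbf{i}'} \right\|_{L_p} \leq \gamma_p. \] Then for all $\mathbf{x} \in \mathbb{R}^{n_1\times\dots\times n_d}$ with $\|\mathbf{x}\|_2 = 1$, \[ \left\| \sum_{\mathbf{i},\mathbf{i}'} B_{\mathbf{i},\mathbf{i}'} x_{\mathbf{i}} x_{\mathbf{i}'} \xi_{\mathbf{i}} \xi_{\mathbf{i}'} - \mathbb{E}\sum_{\mathbf{i},\mathbf{i}'} B_{\mathbf{i},\mathbf{i}'} x_{\mathbf{i}}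 x_{\mathbf{i}'} \xi_{\mathbf{i}} \xi_{\mathbf{i}'} \right\|_{L_p} \leq 5^d \gamma_p. \]
   Context: Sums over $\mathbf{i},\mathbf{i}'$ range over $[n_1]\times\dots\times[n_d]$. $\|X\|_{L_p} = (\mathbb{E}|X|^p)^{1/p}$. $\|\mathbf{x}\|_2$ is the square root of the sum of squares of all entries. A Rademacher vector has independent entries equal to $\pm 1$ with probability $1/2$ each. *)

(* Defs.v *)
From HB Require Import structures.
From mathcomp Require Import all_boot all_order all_algebra.
From mathcomp Require Import all_classical all_reals all_analysis.

Set Implicit Arguments.
Unset Strict Implicit.
Unset Printing Implicit Defensive.

Import Order.TTheory GRing.Theory Num.Theory.
Import numFieldNormedType.Exports.

Local Open Scope classical_set_scope.
Local Open Scope ring_scope.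

Section Independence.
Context {dsp : measure_display} {T : measurableType dsp} {R : realType}.
Variable P : probability T R.

(* A random array indexed by I is a family X : I -> T -> R of random variables,
   seen as a random element of I -> R with the product sigma-algebra. *)

Definition gen_sigma (I : Type) (X : I -> T -> R) : set_system T :=
  <<s \bigcup_i preimage_set_system setT (X i) measurable >>.

Definition prod_sigma (I : Type) : set_system (I -> R) :=
  <<s \bigcup_i preimage_set_system setT (fun x : I -> R => x i) measurable >>.

Definition mutually_independent (I : finType) (F : I -> set_system T) : Prop :=
  forall (J : {set I}) (E : I -> set T),
    (forall i, i \in J -> F i (E i)) ->
    P (\bigcap_(i in [set` J]) E i) = (\prod_(i in J) P (E i))%E.

Definition independent2 (F G : set_system T) : Prop :=
  forall A B, F A -> G B -> P (A `&` B) = (P A * P B)%E.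

Definition same_law (I : Type) (X Y : I -> T -> R) : Prop :=
  forall A : set (I -> R), prod_sigma A ->
    P [set t | A (fun i => X i t)] = P [set t | A (fun i => Y i t)].

Definition independent_copy (I : Type) (X Y : I -> T -> R) : Prop :=
  same_law X Y /\ independent2 (gen_sigma X) (gen_sigma Y).

Definition rademacher (X : T -> R) : Prop :=
  P (X @^-1` [set 1]) = (2^-1)%:E /\ P (X @^-1` [set -1]) = (2^-1)%:E.

Definition rademacher_vector (I : finType) (X : I -> T -> R) : Prop :=
  (forall i, rademacher (X i)) /\
  mutually_independent (fun i => gen_sigma (fun _ : unit => X i)).

End Independence.

(* [n_1] x ... x [n_d], zero-based. *)
Notation multi_index n := {dffun forall l : 'I__, 'I_(n l)}.

Section Arrays.
Context {d : nat}.
Variable n : 'I_d -> nat.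
Context {R : realType}.

Definition norm2 (x : multi_index n -> R) : R :=
  Num.sqrt (\sum_(i : multi_index n) x i ^+ 2).

Definition quad_form (B : multi_index n -> multi_index n -> R)
    (x : multi_index n -> R) (T : Type) (xi zeta : multi_index n -> T -> R)
    (t : T) : R :=
  \sum_(i : multi_index n) \sum_(i' : multi_index n)
    B i i' * x i * x i' * xi i t * zeta i' t.

Definition tensor (T : Type) (xi : forall l : 'I_d, 'I_(n l) -> T -> R)
    (i : multi_index n) (t : T) : R :=
  \prod_(l < d) xi l (i l) t.

End Arrays.

(* Main.v *)
Require Import Defs.
From mathcomp Require Import all_boot all_order all_algebra ring.
From mathcomp Require Import all_classical all_reals all_analysis measurable_realfun.

Set Implicit Arguments.
Unset Strict Implicit.

Import Order.TTheory GRing.Theory Num.Theory.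
Import numFieldNormedType.Exports.

Local Open Scope classical_set_scope.
Local Open Scope ring_scope.

(** Everything reduces to uniform averages over sign vectors. For sign vectors s,
    e, e', let m agree with e where s = 1 and with e' where s = -1. In each
    coordinate direction, for indices j, j',
    [(1 + s_j)(1 - s_j') m_j m_j' = (1 + s_j) e_j (1 - s_j') e'_j'],
    so [j = j'] plus this product is a sum of five terms: the diagonal one and
    four decoupled ones, in which e and e' occur with some signs flipped by s.
    Averaging over s the product over the d directions gives back the chaos in m,
    because [(1 + s_j)(1 - s_j')] has mean 1 off the diagonal and vanishes on it.
    Expanding the product thus bounds the coupled chaos by 5^d partially diagonal
    decoupled ones, the totally diagonal one being the expectation. A chaos that is
    diagonal in the directions I has norm at most gamma: cut x into its
    restrictions to the sets where the I-part of the index is constant, on each of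
    which the signs of I factor out, and use that the squared norms of the pieces
    sum to 1. *)

(** * The L_p norm for the uniform law on a finite set *)

Section FiniteLp.
Context {R : realType} (p : R).

(* E carries the uniform probability, so this says [0 <= c] and [||f||_p <= c]. *)
Definition Lp_le (E : finType) (f : E -> R) (c : R) : Prop :=
  0 <= c /\ \sum_e `|f e| `^ p <= #|E|%:R * c `^ p.

Hypothesis p_ge1 : 1 <= p.

Let p_gt0 : 0 < p. Proof. exact: lt_le_trans p_ge1. Qed.

Lemma powR_divr (a b : R) : 0 <= a -> 0 <= b -> (a / b) `^ p = a `^ p / b `^ p.
Proof.
move=> a0 b0; rewrite powRM ?invr_ge0//; congr (_ * _).
by rewrite -powR_inv1// -powRrM mulN1r powRN.
Qed.

(** Convexity of the p-th power at [|u| / a] and [|v| / b] with weights [a / (a + b)] and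
    [b / (a + b)]. With a and b bounding the two norms, summing it gives Minkowski's inequality. *)
Lemma powR_normD_le (a b u v : R) : 0 < a -> 0 < b ->
  `|u + v| `^ p <=
    (a + b) `^ p * (a / (a + b) * (`|u| `^ p / a `^ p) + b / (a + b) * (`|v| `^ p / b `^ p)).
Proof.
move=> a0 b0; have ab0 : 0 < a + b by rewrite addr_gt0.
have t01 : 0 <= a / (a + b) <= 1.
  by apply/andP; split; rewrite ?divr_ge0 ?ltW// ltr_pdivrMr// mul1r ltrDl.
have /andP[t0 t1] := t01.
have := @convex_powR R p p_ge1 (Itv01 t0 t1) (`|u| / a) (`|v| / b).
rewrite !inE /= !in_itv /= !divr_ge0 ?(ltW a0) ?(ltW b0)// => /(_ isT isT) h.
rewrite [X in X `^ _ <= _]convRE convRE /= /unstable.onem in h.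
have ab : 1 - a / (a + b) = b / (a + b) by field; rewrite gt_eqF.
rewrite ab !powR_divr ?(ltW a0) ?(ltW b0)// in h.
have h2 : `|u + v| `^ p <= (`|u| + `|v|) `^ p.
  by rewrite ge0_ler_powR ?nnegrE ?(ltW p_gt0)// ler_normD.
apply: (le_trans h2).
have {1}-> : `|u| + `|v| = (a + b) * (a / (a + b) * (`|u| / a) + b / (a + b) * (`|v| / b)).
  by field; rewrite !gt_eqF.
rewrite powRM ?addr_ge0 ?mulr_ge0 ?divr_ge0 ?invr_ge0 ?addr_ge0 ?(ltW a0) ?(ltW b0)//.
by rewrite ler_pM2l ?powR_gt0//; exact: h.
Qed.

Lemma Lp_le0 (E : finType) (f : E -> R) : Lp_le f 0 -> forall e, f e = 0.
Proof.
move=> [_]; rewrite powR0 ?gt_eqF// mulr0 => h e; apply/eqP.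
have : `|f e| `^ p <= 0.
  apply: le_trans h; rewrite (bigD1 e)//= lerDl; apply: sumr_ge0 => *; exact: powR_ge0.
by apply: contraTT => fe0; rewrite -ltNge powR_gt0 ?normr_gt0.
Qed.

Lemma le_Lp_le (E : finType) (f g : E -> R) (c : R) :
  (forall e, `|f e| <= `|g e|) -> Lp_le g c -> Lp_le f c.
Proof.
move=> fg [c0 h]; split=> //; apply: le_trans h; apply: ler_sum => e _.
by rewrite ge0_ler_powR ?nnegrE ?(ltW p_gt0).
Qed.

Lemma Lp_leW (E : finType) (f : E -> R) (c c' : R) :
  c <= c' -> Lp_le f c -> Lp_le f c'.
Proof.
move=> cc [c0 h]; split; first exact: le_trans cc.
apply: (le_trans h); rewrite ler_wpM2l// ge0_ler_powR ?nnegrE ?(ltW p_gt0)//.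
exact: le_trans cc.
Qed.

Lemma Lp_leD (E : finType) (f g : E -> R) (a b : R) :
  Lp_le f a -> Lp_le g b -> Lp_le (fun e => f e + g e) (a + b).
Proof.
move=> hf hg; have [a0 fa] := hf; have [b0 gb] := hg.
(* The convexity bound needs a and b positive; a zero bound forces the function itself to vanish. *)
move: a0; rewrite le_eqVlt => /predU1P[a0|a0].
  rewrite -a0 in hf *; rewrite add0r; apply: le_Lp_le hg => e.
  by rewrite (Lp_le0 hf) add0r.
move: b0; rewrite le_eqVlt => /predU1P[b0|b0].
  rewrite -b0 in hg *; rewrite addr0; apply: le_Lp_le hf => e.
  by rewrite (Lp_le0 hg) addr0.
have ab0 : 0 < a + b by rewrite addr_gt0.
split; first exact: ltW.
apply: le_trans (ler_sum _ (fun e _ => powR_normD_le (f e) (g e) a0 b0)) _.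
rewrite -mulr_sumr big_split/= -!mulr_sumr -!mulr_suml mulrC ler_pM2r ?powR_gt0//.
apply: (@le_trans _ _ (a / (a + b) * #|E|%:R + b / (a + b) * #|E|%:R)).
  apply: lerD; apply: ler_wpM2l; rewrite ?divr_ge0 ?(ltW ab0) ?(ltW a0) ?(ltW b0)//.
    by rewrite ler_pdivrMr ?powR_gt0.
  by rewrite ler_pdivrMr ?powR_gt0.
by rewrite -mulrDl -mulrDl divff ?mul1r// gt_eqF.
Qed.

Lemma Lp_le_sum (E I : finType) (Q : pred I) (F : I -> E -> R) (c : I -> R) :
  (forall i, Q i -> Lp_le (F i) (c i)) ->
  Lp_le (fun e => \sum_(i | Q i) F i e) (\sum_(i | Q i) c i).
Proof.
move=> h; elim: (index_enum I) => [|i s IH].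
  split; rewrite ?big_nil// big1 ?mulr_ge0 ?powR_ge0// => e _.
  by rewrite big_nil normr0 powR0 ?gt_eqF.
have [Qi|nQi] := boolP (Q i); rewrite big_cons ?Qi ?(negbTE nQi); last first.
  by apply: le_Lp_le IH => e; rewrite big_cons (negbTE nQi).
apply: le_Lp_le (Lp_leD (h i Qi) IH) => e.
by rewrite big_cons Qi.
Qed.

Lemma Lp_leZ (E : finType) (f : E -> R) (k c : R) :
  Lp_le f c -> Lp_le (fun e => k * f e) (`|k| * c).
Proof.
move=> [c0 h]; split; first by rewrite mulr_ge0.
rewrite powRM// mulrCA; under eq_bigr do rewrite normrM powRM//.
by rewrite -mulr_sumr ler_wpM2l ?powR_ge0.
Qed.

Lemma Lp_le_reindex (E : finType) (h : E -> E) (f : E -> R) (c : R) :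
  injective h -> Lp_le f c -> Lp_le (fun e => f (h e)) c.
Proof.
by move=> hi [c0 hf]; split=> //; rewrite (reindex_inj hi) in hf.
Qed.

(** On the product each value of f is repeated [#|E|] times, so the normalised moments agree. *)
Lemma Lp_le_fst (E : finType) (f : E -> R) (c : R) :
  Lp_le (fun w : E * E => f w.1) c -> Lp_le f c.
Proof.
move=> [c0]; rewrite -(pair_bigA _ (fun a b => `|f a| `^ p)) /=.
under eq_bigr do rewrite sumr_const -mulr_natl.
rewrite -mulr_sumr card_prod natrM -mulrA => h; split=> //.
have [E0|E0] := posnP #|E|; last by rewrite -(ler_pM2l (x := #|E|%:R)) ?ltr0n.
by rewrite E0 mul0r big1// => e _; have := card0_eq E0 e; rewrite inE.
Qed.

End FiniteLp.

(** * Sign vectors and the orthogonality of their tensors *)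

Section SignArrays.
Context {R : realType} {d : nat} (n : 'I_d -> nat).

Lemma dffun_neq (I : finType) (S : I -> eqType) (f g : {dffun forall i, S i}) :
  f != g -> exists i, f i != g i.
Proof.
move=> fg; apply/existsP; rewrite -negb_forall; apply: contra fg => /forallP h.
by apply/eqP/ffunP => i; apply/eqP.
Qed.

(** The coordinates of all d sign vectors in one index type, so that one element of [signs] is a
    joint outcome of the d vectors. *)
Definition sign_index := {l : 'I_d & 'I_(n l)}.
Definition signs := {ffun sign_index -> bool}.

(** The boolean [true] encodes the sign -1. *)
Definition sg (e : signs) (l : 'I_d) (j : 'I_(n l)) : R := (-1) ^+ e (Tagged _ j).

Definition sign_tensor (e : signs) (i : multi_index n) : R := \prod_l sg e (i l).

(** Independence of the coordinates, in unnormalised form. *)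
Lemma sum_signs_prod (g : sign_index -> bool -> R) :
  \sum_(s : signs) \prod_k g k (s k) = \prod_k (g k true + g k false).
Proof.
by rewrite -bigA_distr_bigA; apply: eq_bigr => k _; rewrite big_bool.
Qed.

Lemma card_signs : #|signs|%:R = \prod_(k : sign_index) (2 : R).
Proof. by rewrite prodr_const card_ffun card_bool natrX. Qed.

Lemma prod_coord (g : forall l : 'I_d, 'I_(n l) -> R) :
  \prod_(k : sign_index) g (tag k) (tagged k) = \prod_l \prod_(j < n l) g l j.
Proof. by rewrite sig_big_dep. Qed.

Lemma sgK (e : signs) (l : 'I_d) (j : 'I_(n l)) : sg e j * sg e j = 1.
Proof. by rewrite /sg -expr2 sqrr_sign. Qed.

(** If i and i' differ in direction l, the sign at [i l] occurs exactly once in the product and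
    averages to zero. *)
Lemma sum_sign_tensorM (i i' : multi_index n) :
  \sum_e sign_tensor e i * sign_tensor e i' = #|signs|%:R * (i == i')%:R.
Proof.
have [<-|ii'] := eqVneq i i'.
  rewrite mulr1; under eq_bigr => e _.
    by rewrite /sign_tensor -big_split big1 /=; [over|move=> l _; exact: sgK].
  by rewrite sumr_const -mulr_natl mulr1.
(* The product of the two tensors is rewritten over all coordinates, with factor 1 at those selected
   by neither index. *)
pose g (k : sign_index) (b : bool) : R :=
  (if tagged k == i (tag k) then (-1) ^+ b else 1) *
  (if tagged k == i' (tag k) then (-1) ^+ b else 1).
transitivity (\sum_(e : signs) \prod_k g k (e k)).
  apply: eq_bigr => e _.
  transitivity (\prod_(k : sign_index) ((if tagged k == i (tag k) then sg e (tagged k) else 1) *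
     (if tagged k == i' (tag k) then sg e (tagged k) else 1))).
    rewrite (prod_coord (fun l j => (if j == i l then sg e j else 1) *
      (if j == i' l then sg e j else 1))) /sign_tensor -big_split.
    apply: eq_bigr => l _ /=.
    by rewrite big_split -!big_mkcond !big_pred1_eq.
  by apply: eq_bigr => -[l j] _.
rewrite sum_signs_prod mulr0.
have [l hl] := dffun_neq ii'.
rewrite (bigD1 (Tagged (fun l => 'I_(n l)) (i l)))//= /g /= eqxx (negbTE hl).
by rewrite !mulr1 expr1 expr0 addNr mul0r.
Qed.

(** * Splitting each direction into five modes *)

Definition diag_split (s m : signs) (l : 'I_d) (j j' : 'I_(n l)) : R :=
  (j == j')%:R + (1 + sg s j) * (1 - sg s j') * (sg m j * sg m j').

(** Where i and i' agree, [(1 + s) * (1 - s) = 0] leaves the factor 1, which is the square of a sign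
    of m. Where they differ, the two factors in s sit at distinct coordinates, hence are
    independent, and each has mean 1. *)
Lemma sum_diag_split (m : signs) (i i' : multi_index n) :
  \sum_s \prod_l diag_split s m (i l) (i' l) =
  #|signs|%:R * (sign_tensor m i * sign_tensor m i').
Proof.
pose h (s : signs) (k : sign_index) (b : bool) : R :=
  if i (tag k) == i' (tag k) then 1 else
  (if tagged k == i (tag k) then 1 + (-1) ^+ b else 1) *
  (if tagged k == i' (tag k) then 1 - (-1) ^+ b else 1).
transitivity (\sum_(s : signs) (sign_tensor m i * sign_tensor m i') * \prod_k h s k (s k)).
  apply: eq_bigr => s _.
  transitivity ((sign_tensor m i * sign_tensor m i') * \prod_(k : sign_index)
    (if i (tag k) == i' (tag k) then 1 else
     (if tagged k == i (tag k) then 1 + sg s (tagged k) else 1) *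
     (if tagged k == i' (tag k) then 1 - sg s (tagged k) else 1))); last first.
    by congr (_ * _); apply: eq_bigr => -[l j] _.
  rewrite (prod_coord (fun l j => if i l == i' l then 1 else
     (if j == i l then 1 + sg s j else 1) * (if j == i' l then 1 - sg s j else 1))).
  rewrite /sign_tensor -!big_split; apply: eq_bigr => l _ /=.
  rewrite /diag_split; have [<-|_] := eqVneq (i l) (i' l).
    have -> : (1 + sg s (i l)) * (1 - sg s (i l)) = 1 - sg s (i l) * sg s (i l) by ring.
    by rewrite !sgK big1// subrr mul0r addr0 mulr1.
  by rewrite add0r big_split -!big_mkcond !big_pred1_eq mulrC.
rewrite -mulr_sumr mulrC; congr (_ * _).
(* Every coordinate sums to 2: its two values are 0 and 2 at an entry chosen in a direction where i
   and i' differ, and 1 and 1 elsewhere. *)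
rewrite (sum_signs_prod (h [ffun=> true])) card_signs; apply: eq_bigr => -[l j] _.
rewrite /h /= expr1 expr0; have [_|ii'] := eqVneq (i l) (i' l); first by [].
have [->|_] := eqVneq j (i l); first by rewrite (negbTE ii'); ring.
by case: ifP => _; ring.
Qed.

Definition mix (s e e' : signs) : signs := [ffun k => if s k then e' k else e k].

Definition flip (J : pred 'I_d) (s e : signs) : signs :=
  [ffun k => e k (+) (J (tag k) && s k)].

Definition flip_left (o : option (bool * bool)) := if o is Some (a, _) then a else false.
Definition flip_right (o : option (bool * bool)) := if o is Some (_, b) then b else false.

(* [None] is the diagonal term; [Some (a, b)] is a decoupled one, where a and b tell
   whether the sign at j, resp. j', is flipped by s. *)
Definition mode_factor (s e e' : signs) (o : option (bool * bool)) (l : 'I_d) (j j' : 'I_(n l)) : R :=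
  if o is Some (a, b) then
    (-1) ^+ b * (sg s j ^+ a * sg e j * (sg s j' ^+ b * sg e' j'))
  else (j == j')%:R.

(** The factor [1 + sg s j] vanishes unless the mix takes e at j, and [1 - sg s j'] vanishes unless
    it takes e' at j'. So the mix can be replaced by e and e', and multiplying out gives the four
    decoupled terms. *)
Lemma diag_split_mix (s e e' : signs) (l : 'I_d) (j j' : 'I_(n l)) :
  diag_split s (mix s e e') j j' =
  \sum_(o : option (bool * bool)) mode_factor s e e' o j j'.
Proof.
rewrite (bigD1 None)//= (reindex_omap Some id) => [|[]//] /=.
rewrite (eq_bigl predT) => [|o]; last by rewrite eqxx.
rewrite (eq_bigr (fun q => mode_factor s e e' (Some (q.1, q.2)) j j')) => [|[]//].
rewrite -(pair_bigA _ (fun a b => mode_factor s e e' (Some (a, b)) j j')) /=.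
rewrite !big_bool /mode_factor /diag_split; congr (_ + _).
have h1 : (1 + sg s j) * sg (mix s e e') j = (1 + sg s j) * sg e j.
  by rewrite /sg ffunE; case: (s _) => //; rewrite expr1 subrr !mul0r.
have h2 : (1 - sg s j') * sg (mix s e e') j' = (1 - sg s j') * sg e' j'.
  by rewrite /sg ffunE; case: (s _) => //; rewrite expr0 subrr !mul0r.
rewrite mulrACA h1 h2 /= !(expr0, expr1).
rewrite !mul1r !mulN1r. 
move: (sg s j) (sg e j) (sg s j') (sg e' j') => a b c f. ring.
Qed.


Lemma sg_flip (J : pred 'I_d) (s e : signs) (l : 'I_d) (j : 'I_(n l)) :
  sg (flip J s e) j = sg s j ^+ J l * sg e j.
Proof.
by rewrite /sg ffunE signr_addb mulrC -[J _]/(J l); case: (J l); rewrite ?expr1.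
Qed.

Lemma mode_factorE (s e e' : signs) (f : {ffun 'I_d -> option (bool * bool)}) (l : 'I_d)
    (j j' : 'I_(n l)) :
  mode_factor s e e' (f l) j j' = (-1) ^+ flip_right (f l) *
    (if f l == None then (j == j')%:R else
       sg (flip (flip_left \o f) s e) j * sg (flip (flip_right \o f) s e') j').
Proof.
rewrite !sg_flip /mode_factor /=; case: (f l) => [[a b]|] //=.
by rewrite mul1r.
Qed.

(** For fixed s a flip thus permutes the sign vectors and preserves uniform averages. *)
Lemma flip_inj (J : pred 'I_d) (s : signs) : injective (flip J s).
Proof.
move=> e1 e2 /ffunP h; apply/ffunP => k; have := h k; rewrite !ffunE.
exact: addIb.
Qed.

(** * Expansion of the chaos and its diagonal term *)

Definition bilinear (B : multi_index n -> multi_index n -> R)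
    (x u v : multi_index n -> R) : R :=
  \sum_i \sum_i' B i i' * x i * x i' * u i * v i'.

Definition partial_bilinear (B : multi_index n -> multi_index n -> R)
    (x : multi_index n -> R) (I : pred 'I_d) (e e' : signs) : R :=
  \sum_i \sum_i' B i i' * x i * x i' *
    \prod_l (if I l then (i l == i' l)%:R else sg e (i l) * sg e' (i' l)).

Lemma bilinear_split (B : multi_index n -> multi_index n -> R)
    (x : multi_index n -> R) (m : signs) :
  #|signs|%:R * bilinear B x (sign_tensor m) (sign_tensor m) =
  \sum_s \sum_i \sum_i' B i i' * x i * x i' *
    \prod_l diag_split s m (i l) (i' l).
Proof.
rewrite [RHS]exchange_big mulr_sumr; apply: eq_bigr => i _ /=.
rewrite [RHS]exchange_big mulr_sumr; apply: eq_bigr => i' _ /=.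
rewrite -mulr_sumr sum_diag_split; ring.
Qed.

(** Distributivity over the directions: f chooses one of five modes in each, and the diagonal
    directions are those where it chooses [None]. *)
Lemma diag_split_mix_sum (B : multi_index n -> multi_index n -> R)
    (x : multi_index n -> R) (s e e' : signs) :
  \sum_i \sum_i' B i i' * x i * x i' *
    \prod_l diag_split s (mix s e e') (i l) (i' l) =
  \sum_(f : {ffun 'I_d -> option (bool * bool)})
    (\prod_l (-1) ^+ flip_right (f l)) *
    partial_bilinear B x (fun l => f l == None)
      (flip (flip_left \o f) s e) (flip (flip_right \o f) s e').
Proof.
under [RHS]eq_bigr do rewrite mulr_sumr; rewrite [RHS]exchange_big.
apply: eq_bigr => i _ /=.
under [RHS]eq_bigr do rewrite mulr_sumr; rewrite [RHS]exchange_big.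
apply: eq_bigr => i' _ /=.
under eq_bigr do rewrite diag_split_mix.
rewrite bigA_distr_bigA mulr_sumr; apply: eq_bigr => f _.
rewrite mulrCA -big_split /=; congr (_ * _).
by apply: eq_bigr => l _; exact: mode_factorE.
Qed.

(** Two indices that agree in every direction coincide. The value is the expectation of the coupled
    chaos, so this term cancels against the centring. *)
Lemma partial_bilinear_diag (B : multi_index n -> multi_index n -> R)
    (x : multi_index n -> R) (e e' : signs) :
  partial_bilinear B x predT e e' = \sum_i B i i * x i ^+ 2.
Proof.
apply: eq_bigr => i _; rewrite (bigD1 i)//= [X in _ + X]big1 ?addr0.
  by rewrite big1 ?mulr1 -?mulrA -?expr2// => l _; rewrite eqxx.
move=> i' ii'; have [l hl] : exists l, i l != i' l by apply: dffun_neq; rewrite eq_sym.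
by rewrite (bigD1 l)//= (negbTE hl) mul0r mulr0.
Qed.

(** Orthogonality of the sign tensors leaves only the terms with i = i'. *)
Lemma sum_bilinear_sign (B : multi_index n -> multi_index n -> R)
    (x : multi_index n -> R) :
  \sum_e bilinear B x (sign_tensor e) (sign_tensor e) =
  #|signs|%:R * \sum_i B i i * x i ^+ 2.
Proof.
rewrite exchange_big mulr_sumr; apply: eq_bigr => i _ /=.
rewrite exchange_big (bigD1 i)//= [X in _ + X]big1 ?addr0 => [|i' ii'];
  under eq_bigr do rewrite -mulrA; rewrite -mulr_sumr sum_sign_tensorM.
  by rewrite eqxx mulr1 -[_ * x i * x i]mulrA -expr2 mulrC.
by rewrite eq_sym (negbTE ii') !mulr0.
Qed.

(** * Scaling and restriction to cells *)

Lemma bilinear_scale (B : multi_index n -> multi_index n -> R) (a : R)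
    (x u v : multi_index n -> R) :
  bilinear B (fun i => a * x i) u v = a ^+ 2 * bilinear B x u v.
Proof.
rewrite /bilinear mulr_sumr; apply: eq_bigr => i _.
rewrite mulr_sumr; apply: eq_bigr => i' _; ring.
Qed.

(* The part of the index i in the directions I. *)
Definition cell (I : pred 'I_d) (i : multi_index n) :
    {dffun forall l : 'I_d, option 'I_(n l)} :=
  finfun (fun l => if I l then Some (i l) else None).

(** The factor that the directions fixed by the cell k contribute to a sign tensor. *)
Definition cell_sign (k : {dffun forall l : 'I_d, option 'I_(n l)}) (e : signs) : R :=
  \prod_l (if k l is Some j then sg e j else 1).

Lemma cell_eq (I : pred 'I_d) (i i' : multi_index n) :
  (cell I i == cell I i')%:R = \prod_l (if I l then (i l == i' l)%:R else 1) :> R.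
Proof.
have [/ffunP h|h] := eqVneq (cell I i) (cell I i').
  rewrite big1// => l _; have := h l; rewrite !ffunE.
  by case: (I l) => // -[->]; rewrite eqxx.
have [l hl] := dffun_neq h.
rewrite (bigD1 l)//=; move: hl; rewrite !ffunE; case: (I l); rewrite ?eqxx// => hl.
by rewrite (_ : _ == _ = false) ?mul0r//; apply: contraNF hl => /eqP ->.
Qed.

Lemma sign_tensor_cell (I : pred 'I_d) (e : signs) (i : multi_index n) :
  sign_tensor e i = cell_sign (cell I i) e * \prod_l (if I l then 1 else sg e (i l)).
Proof.
rewrite /cell_sign -big_split; apply: eq_bigr => l _ /=; rewrite ffunE.
by case: (I l); rewrite ?mulr1 ?mul1r.
Qed.

Lemma cell_signK k (e : signs) : cell_sign k e * cell_sign k e = 1.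
Proof.
rewrite -big_split big1// => l _ /=; case: (k l) => [j|]; last by rewrite mul1r.
exact: sgK.
Qed.

Lemma norm_cell_sign k (e : signs) : `|cell_sign k e| = 1.
Proof. by apply/eqP; rewrite -sqr_norm_eq1 expr2 cell_signK. Qed.

(** Agreement of i and i' in the directions I means that they share a cell. There the missing signs
    of I are constant and can be inserted, compensated by the two cell signs. *)
Lemma partial_bilinear_cell (B : multi_index n -> multi_index n -> R)
    (x : multi_index n -> R) (I : pred 'I_d) (e e' : signs) :
  partial_bilinear B x I e e' = \sum_k cell_sign k e * cell_sign k e' *
    bilinear B (fun i => x i * (cell I i == k)%:R) (sign_tensor e) (sign_tensor e').
Proof.
under [RHS]eq_bigr do rewrite mulr_sumr; rewrite [RHS]exchange_big.
apply: eq_bigr => i _ /=.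
under [RHS]eq_bigr do rewrite mulr_sumr; rewrite [RHS]exchange_big.
apply: eq_bigr => i' _ /=.
rewrite (bigD1 (cell I i))//= eqxx [X in _ + X]big1 ?addr0; last first.
  by move=> k; rewrite eq_sym => /negbTE ->; rewrite !(mulr0, mul0r).
transitivity (B i i' * x i * x i' * ((cell I i' == cell I i)%:R *
   (\prod_l (if I l then 1 else sg e (i l)) * \prod_l (if I l then 1 else sg e' (i' l))))).
  rewrite eq_sym cell_eq -!big_split; congr (_ * _); apply: eq_bigr => l _ /=.
  by case: (I l); rewrite ?mulr1 ?mul1r.
have [hc|_] := eqVneq (cell I i') (cell I i); last by rewrite !(mulr0, mul0r).
rewrite (sign_tensor_cell I e) (sign_tensor_cell I e') hc.
move: (cell_signK (cell I i) e) (cell_signK (cell I i) e').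
move: (cell_sign _ e) (cell_sign _ e') (\prod_l _) (\prod_l _) => a b u v ha hb.
(* Each cell sign occurs twice, once as compensation and once inside the tensor, so only squares
   equal to 1 appear. *)
transitivity (B i i' * x i * x i' * ((a * a) * (b * b) * (u * v))); last by rewrite /=; ring.
by rewrite ha hb mulr1n !mul1r (mulrC v).
Qed.

End SignArrays.

(** * Decoupling for uniform sign vectors *)

Section FiniteDecoupling.
Context {R : realType} {d : nat} (n : 'I_d -> nat).
Variables (p gamma : R) (B : multi_index n -> multi_index n -> R).
Hypothesis p_ge1 : 1 <= p.
Hypothesis decoupled_le : forall x : multi_index n -> R, norm2 x = 1 ->
  Lp_le p (fun w : signs n * signs n =>
    bilinear B x (sign_tensor w.1) (sign_tensor w.2)) gamma.

Lemma norm2_sqr (x : multi_index n -> R) : norm2 x ^+ 2 = \sum_i x i ^+ 2.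
Proof. by rewrite sqr_sqrtr// sumr_ge0// => i _; exact: sqr_ge0. Qed.

(** The chaos is quadratic in x, so normalising extends the bound to every x; the zero array, which
    cannot be normalised, gives the zero chaos. *)
Let decoupled_scaled (x : multi_index n -> R) :
  Lp_le p (fun w : signs n * signs n =>
    bilinear B x (sign_tensor w.1) (sign_tensor w.2)) (norm2 x ^+ 2 * gamma).
Proof.
have [x0|x0] := eqVneq (norm2 x) 0.
  have xi0 i : x i = 0.
    apply/eqP; rewrite -sqrf_eq0 -[_ == 0]andTb.
    have : \sum_i x i ^+ 2 == 0 by rewrite -norm2_sqr x0 expr0n.
    by rewrite psumr_eq0 => [/allP/(_ i (mem_index_enum i))|j _] //; exact: sqr_ge0.
  rewrite x0 expr0n mul0r; split=> //.
  rewrite powR0 ?gt_eqF ?(lt_le_trans ltr01)// mulr0 big1// => w _.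
  rewrite /bilinear big1 ?normr0 ?powR0 ?gt_eqF ?(lt_le_trans ltr01)// => i _.
  by rewrite big1// => i' _; rewrite xi0 !(mulr0, mul0r).
pose y i := (norm2 x)^-1 * x i.
have ny : norm2 y = 1.
  apply/eqP; rewrite -(@eqrXn2 _ 2)// ?sqrtr_ge0// norm2_sqr.
  under eq_bigr do rewrite exprMn.
  by rewrite -mulr_sumr -norm2_sqr -exprMn mulVf// expr1n.
have := Lp_leZ (norm2 x ^+ 2) (decoupled_le ny).
rewrite ger0_norm ?sqr_ge0//; apply: le_Lp_le => // w.
rewrite /y bilinear_scale mulrA -exprMn mulfV// expr1n mul1r//.
Qed.

Lemma partial_bilinear_le (x : multi_index n -> R) (I : pred 'I_d) : norm2 x = 1 ->
  Lp_le p (fun w : signs n * signs n => partial_bilinear B x I w.1 w.2) gamma.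
Proof.
move=> x1.
(* Each index lies in exactly one cell, so the squared norms of the restrictions sum to 1. *)
have {1}-> : gamma = \sum_k norm2 (fun i => x i * (cell I i == k)%:R) ^+ 2 * gamma.
  rewrite -mulr_suml; under eq_bigr do rewrite norm2_sqr.
  rewrite exchange_big /= (eq_bigr (fun i => x i ^+ 2)) => [|i _].
    by rewrite -norm2_sqr x1 expr1n mul1r.
  rewrite (bigD1 (cell I i))//= eqxx mulr1 big1 ?addr0// => k.
  by rewrite eq_sym => /negbTE ->; rewrite mulr0 expr0n.
apply: (le_Lp_le p_ge1 (g := fun w => \sum_k cell_sign k w.1 * cell_sign k w.2 *
    bilinear B (fun i => x i * (cell I i == k)%:R) (sign_tensor w.1) (sign_tensor w.2))).
  by move=> w; rewrite partial_bilinear_cell.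
apply: (Lp_le_sum p_ge1) => k _; apply: le_Lp_le (decoupled_scaled _) => // w.
by rewrite !normrM !norm_cell_sign !mul1r.
Qed.

Lemma decoupling_le (x : multi_index n -> R) : norm2 x = 1 ->
  Lp_le p (fun m : signs n => bilinear B x (sign_tensor m) (sign_tensor m) -
    \sum_i B i i * x i ^+ 2) (5 ^+ d * gamma).
Proof.
move=> x1; have gamma0 : 0 <= gamma by have [] := decoupled_le x1.
pose c := \sum_i B i i * x i ^+ 2.
(* The contribution of one fixed s; averaging it over s gives back the centred chaos. *)
pose F s m := \sum_i \sum_i' B i i' * x i * x i' *
    \prod_l diag_split s m (i l) (i' l) - c.
have cs0 : #|signs n|%:R != 0 :> R.
  by rewrite pnatr_eq0 card_ffun card_bool expn_eq0.
have F_le s : Lp_le p (F s) (5 ^+ d * gamma).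
  apply: Lp_le_fst.
  (* Completing the mix by its mirror image makes it an involution on pairs, so the mix of two
     independent uniform sign vectors is again uniform. *)
  pose h (w : signs n * signs n) := (mix s w.1 w.2, mix s w.2 w.1).
  have hK : involutive h.
    by move=> [a b]; congr (_, _); apply/ffunP => k; rewrite !ffunE; case: (s k).
  suff : Lp_le p (fun w => F s (h w).1) (5 ^+ d * gamma).
    by move/(Lp_le_reindex (inv_inj hK)); under [F in Lp_le _ F]eq_fun do rewrite hK.
  pose f0 : {ffun 'I_d -> option (bool * bool)} := [ffun=> None].
  have FE w : F s (h w).1 = \sum_(f | f != f0) (\prod_l (-1) ^+ flip_right (f l)) *
    partial_bilinear B x (fun l => f l == None)
      (flip (flip_left \o f) s w.1) (flip (flip_right \o f) s w.2).
    rewrite /F /= diag_split_mix_sum (bigD1 f0)//=.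
    rewrite big1 => [|l _]; last by rewrite ffunE expr0.
    rewrite mul1r (_ : (fun l => f0 l == None) = predT).
      by rewrite partial_bilinear_diag addrAC subrr add0r.
    by apply/funext => l; rewrite ffunE eqxx.
  apply: (le_Lp_le p_ge1 (g := fun w => \sum_(f | f != f0) (\prod_l (-1) ^+ flip_right (f l)) *
    partial_bilinear B x (fun l => f l == None)
      (flip (flip_left \o f) s w.1) (flip (flip_right \o f) s w.2))).
    by move=> w; rewrite FE.
  (* Putting the cancelled term [f0] back at cost gamma gives the round count: five modes in each of
     d directions. *)
  apply: (@Lp_leW _ _ p_ge1 _ _ (\sum_(f | f != f0) gamma)).
    apply: (@le_trans _ _ (\sum_(f : {ffun 'I_d -> option (bool * bool)}) gamma)).
      by rewrite [leRHS](bigD1 f0)//= lerDr.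
    by rewrite sumr_const card_ffun card_option card_prod card_bool card_ord
      -[leLHS]mulr_natl natrX.
  apply: (Lp_le_sum p_ge1) => f _.
  pose g (w : signs n * signs n) :=
    (flip (flip_left \o f) s w.1, flip (flip_right \o f) s w.2).
  have g_inj : injective g by move=> [a b] [a' b'] [/flip_inj -> /flip_inj ->].
  have := Lp_le_reindex g_inj (partial_bilinear_le (fun l => f l == None) x1).
  apply: le_Lp_le => // w; rewrite normrM normr_prod big1 ?mul1r// => l _.
  exact: normr_sign.
(* The triangle inequality for the average over s; the bound is the same for every s. *)
have := Lp_leZ (#|signs n|%:R^-1) (Lp_le_sum p_ge1 (Q := predT) (fun s _ => F_le s)).
rewrite sumr_const -[X in `|_| * X]mulr_natl ger0_norm ?invr_ge0 ?ler0n// mulKf//.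
apply: le_Lp_le => // m.
rewrite big_split /= -bilinear_split sumr_const -(mulr_natl (- _)).
by rewrite -mulrDr mulKf.
Qed.

End FiniteDecoupling.

(** * Integrals of functions with finitely many values almost surely *)

Section DiscreteLaw.
Context {dsp : measure_display} {T : measurableType dsp} {R : realType}.
Variable P : probability T R.

(** The events are disjoint with total mass 1, so the complement of their union is null, and f is
    constant on each of them. *)
Lemma integral_discrete (E : finType) (A : E -> set T) (q : E -> R) (f : T -> R) (c : E -> R) :
  measurable_fun setT f -> (forall e, measurable (A e)) ->
  (forall e e' t, A e t -> A e' t -> e = e') ->
  (forall e, P (A e) = (q e)%:E) -> \sum_e q e = 1 ->
  (forall e t, A e t -> f t = c e) ->
  (\int[P]_t (f t)%:E = (\sum_e c e * q e)%:E)%E.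
Proof.
move=> mf mA dA PA q1 fA.
pose D := \big[setU/set0]_(e <- enum E) A e.
have mD : measurable D by apply: bigsetU_measurable.
have tA : trivIset [set` enum E] A by move=> e e' _ _ [t []]; exact: dA.
(* Used twice: for the constant 1, which shows that D has full mass, and for f. *)
have step (g : T -> R) (a : E -> R) : measurable_fun setT g ->
    (forall e t, A e t -> g t = a e) ->
    (\int[P]_(t in D) (g t)%:E = (\sum_e a e * q e)%:E)%E.
  move=> mg gA; rewrite integral_bigsetU_EFin ?enum_uniq//; last first.
    by apply/measurable_EFinP; exact: measurable_funTS.
  rewrite big_enum -sumEFin; apply: eq_bigr => e _.
  rewrite EFinM -PA -integral_cst//; apply: eq_integral => t.
  by rewrite inE => /gA ->.
have PD : P D = 1%:E.
  have := step (cst 1) (fun=> 1) (measurable_cst _) (fun _ _ _ => erefl).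
  rewrite (eq_integral (cst 1%:E))// integral_cst// mul1e => ->.
  by under eq_bigr do rewrite mul1r; rewrite q1.
have PCD : P (~` D) = 0%E by rewrite probability_setC// PD subee.
have mfE U : measurable_fun U (EFin \o f).
  by apply/measurable_EFinP; exact: measurable_funTS.
rewrite -(setUv D) integral_setU//; last 2 first.
- exact: measurableC.
- by apply/disj_setPS; rewrite setICr.
by rewrite (step _ c)// null_set_integral ?adde0//; exact: measurableC.
Qed.

(** Turns a norm bound into a bound on the p-th moment M, since the powers p and [p^-1] are monotone
    and mutually inverse on nonnegative reals. *)
Lemma Lnorm_le (f : T -> R) (p M c : R) : 1 <= p -> 0 <= M -> 0 <= c ->
  (\int[P]_t (`|f t| `^ p)%:E = M%:E)%E ->
  ('N[P]_(p%:E)[(fun t => (f t)%:E)] <= c%:E)%E = (M <= c `^ p).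
Proof.
move=> p1 M0 c0 fM; have p0 : 0 < p by exact: lt_le_trans p1.
rewrite unlock /= fM poweR_EFin lee_fin.
have pV a : 0 <= a -> (a `^ p^-1) `^ p = a.
  by move=> a0; rewrite -powRrM mulVf ?gt_eqF// powRr1.
have Vp a : 0 <= a -> (a `^ p) `^ p^-1 = a.
  by move=> a0; rewrite -powRrM mulfV ?gt_eqF// powRr1.
apply/idP/idP => h.
  by rewrite -(pV M)// ge0_ler_powR ?nnegrE ?powR_ge0 ?(ltW p0).
by rewrite -(Vp c)// ge0_ler_powR ?nnegrE ?powR_ge0 ?invr_ge0 ?(ltW p0).
Qed.

Lemma measurable_eq_family (I : finType) (X : I -> T -> R) (v : I -> R) :
  (forall i, measurable_fun setT (X i)) -> measurable [set t | forall i, X i t = v i].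
Proof.
move=> mX; rewrite (_ : [set t | _] = \bigcap_(i in setT) (X i @^-1` [set v i])).
  apply: fin_bigcap_measurable => // i _.
  by rewrite -[X in measurable X]setTI; apply: mX.
by apply/seteqP; split=> t /= h i; [move=> _; exact: h|exact: h].
Qed.

End DiscreteLaw.

(** * Events of the generated sigma-algebras *)

Section GeneratedEvents.
Context {R : realType}.

(** A finite intersection of generators. This brings events that prescribe all values within reach
    of the independence and equal-law hypotheses. *)
Lemma gen_eq_family (U : pointedType) (I : finType) (X : I -> U -> R) (v : I -> R) :
  <<s \bigcup_i preimage_set_system setT (X i) measurable >>
    [set u | forall i, X i u = v i].
Proof.
set G := \bigcup_i _.
rewrite (_ : [set u | _] = \bigcap_(i in setT) (X i @^-1` [set v i])); last first.
  by apply/seteqP; split=> t /= h i; [move=> _; exact: h|exact: h].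
have : G.-sigma.-measurable (\bigcap_(i in setT) (X i @^-1` [set v i])).
  apply: (@fin_bigcap_measurable _ (g_sigma_algebraType G)) => // i _.
  apply: sub_sigma_algebra; exists i => //; exists [set v i] => //.
  by rewrite setTI.
exact.
Qed.

End GeneratedEvents.

(** * The joint law of the Rademacher vectors *)

Section RademacherTensor.
Context {R : realType} {dsp : measure_display} {T : measurableType dsp}.
Variables (P : probability T R) (d : nat) (n : 'I_d -> nat).
Unset Implicit Arguments.
Variable xi : forall l : 'I_d, 'I_(n l) -> {RV P >-> R}.
Hypothesis xi_rademacher :
  forall l : 'I_d, rademacher_vector P (fun k => xi l k : T -> R).
Hypothesis xi_indep : mutually_independent P
  (fun l : 'I_d => gen_sigma (fun k => xi l k : T -> R)).

Set Implicit Arguments.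

Let xi_tensor : multi_index n -> T -> R := tensor (fun l k => xi l k : T -> R).

Let sign_event (e : signs n) : set T := [set t | forall l (j : 'I_(n l)), xi l j t = sg e j].

Let block_event (e : signs n) (l : 'I_d) : set T :=
  [set t | forall j : 'I_(n l), xi l j t = sg e j].

Lemma prob_block_event (e : signs n) (l : 'I_d) :
  P (block_event e l) = (\prod_(j < n l) 2^-1)%:E.
Proof.
have [rad indep] := xi_rademacher l.
(* The quantifier over [unit] matches the sigma-algebra of a single variable, generated by a family
   indexed by [unit]. *)
have /= := indep [set: 'I_(n l)]%SET (fun j => [set t | unit -> xi l j t = sg e j]).
rewrite (_ : \bigcap_(j in _) _ = block_event e l); last first.
  apply/seteqP; split=> t /= h j; first by apply: h => //=; rewrite inE.
  by move=> _ _; exact: h.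
move=> -> => [|j _]; last first.
  exact: (@gen_eq_family R T unit (fun=> xi l j) (fun=> sg e j)).
rewrite -prodEFin (eq_bigl predT) => [|j]; last by rewrite inE.
apply: eq_bigr => j _; have [rad1 radN1] := rad j.
transitivity (P (xi l j @^-1` [set sg e j])).
  by congr (P _); apply/seteqP; split=> t /= => [/(_ tt)|->].
by rewrite /sg; case: (e _); rewrite ?expr1 ?expr0.
Qed.

(** Independence between the blocks, after independence inside each, makes all sign patterns equally
    likely. *)
Lemma prob_sign_event (e : signs n) : P (sign_event e) = (#|signs n|%:R^-1)%:E.
Proof.
have := xi_indep [set: 'I_d]%SET (block_event e).
rewrite (_ : \bigcap_(l in _) _ = sign_event e); last first.
  apply/seteqP; split=> t /= h l; first by apply: h => //=; rewrite inE.
  by move=> _; exact: h.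
move=> -> => [|l _]; last exact: gen_eq_family.
rewrite card_signs -prodfV (prod_coord (fun l j => 2^-1)) -prodEFin.
by apply: eq_big => [l|l _]; [rewrite inE|exact: prob_block_event].
Qed.

Lemma measurable_sign_event (e : signs n) : measurable (sign_event e).
Proof.
rewrite (_ : sign_event e = [set t | forall k : sign_index n, xi (tag k) (tagged k) t = sg e (tagged k)]).
  by apply: measurable_eq_family => k; exact: measurable_funPT.
apply/seteqP; split=> t /= h; first by move=> k; exact: h.
by move=> l j; exact: (h (Tagged (fun l => 'I_(n l)) j)).
Qed.

Lemma sign_event_inj (e e' : signs n) (t : T) :
  sign_event e t -> sign_event e' t -> e = e'.
Proof.
move=> h h'; apply/ffunP => -[l j]; apply/(@signr_inj R).
exact: etrans (esym (h l j)) (h' l j).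
Qed.

Lemma xi_tensor_sign (e : signs n) (t : T) (i : multi_index n) :
  sign_event e t -> xi_tensor i t = sign_tensor e i.
Proof. by move=> h; apply: eq_bigr => l _; exact: h. Qed.

Lemma measurable_xi_tensor (i : multi_index n) : measurable_fun setT (xi_tensor i).
Proof. by apply: measurable_prod => l _; exact: measurable_funPT. Qed.

Let card_signs_neq0 : #|signs n|%:R != 0 :> R.
Proof. by rewrite pnatr_eq0 card_ffun card_bool expn_eq0. Qed.

Lemma integral_sign (f : T -> R) (c : signs n -> R) : measurable_fun setT f ->
  (forall e t, sign_event e t -> f t = c e) ->
  (\int[P]_t (f t)%:E = (#|signs n|%:R^-1 * \sum_e c e)%:E)%E.
Proof.
move=> mf fc; rewrite (integral_discrete (A := sign_event) (q := fun=> #|signs n|%:R^-1) (c := c))//.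
- by rewrite -mulr_suml mulrC.
- exact: measurable_sign_event.
- exact: sign_event_inj.
- exact: prob_sign_event.
- by rewrite sumr_const -[LHS]mulr_natl mulfV.
Qed.

(** * The law of the tensor and of its independent copy *)

Definition array_sign (v : {ffun multi_index n -> bool}) (i : multi_index n) : R := (-1) ^+ v i.

(** The copy comes as an array with the right law, without underlying sign vectors, so the values of
    both arrays are recorded as boolean arrays. Products of signs become exclusive ors. *)
Definition tensor_code (e : signs n) : {ffun multi_index n -> bool} :=
  [ffun i : multi_index n => \big[addb/false]_l e (Tagged (fun l => 'I_(n l)) (i l))].

Lemma tensor_codeE (e : signs n) (i : multi_index n) :
  sign_tensor e i = array_sign (tensor_code e) i :> R.
Proof.
rewrite /array_sign ffunE /sign_tensor /sg.
by elim/big_rec2: _ => [|l x b _ ->]; rewrite ?expr0// signr_addb.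
Qed.

(** The image of the uniform law under [tensor_code], which need not be injective. *)
Let law (v : {ffun multi_index n -> bool}) : R :=
  #|signs n|%:R^-1 * \sum_e (tensor_code e == v)%:R.

Let code_event (X : multi_index n -> T -> R) (v : {ffun multi_index n -> bool}) : set T :=
  [set t | forall i, X i t = array_sign v i].

Lemma array_sign_inj (v w : {ffun multi_index n -> bool}) :
  array_sign v =1 array_sign w -> v = w.
Proof.
by move=> h; apply/ffunP => i; exact: signr_inj (h i).
Qed.

Lemma prob_code_event v : P (code_event xi_tensor v) = (law v)%:E.
Proof.
have mC : measurable (code_event xi_tensor v).
  by apply: measurable_eq_family; exact: measurable_xi_tensor.
rewrite -expectation_indic// unlock.
rewrite (integral_sign (c := fun e => (tensor_code e == v)%:R))// => e t h.
rewrite indicE; congr (nat_of_bool _)%:R; apply/idP/eqP; rewrite inE.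
  by move=> hv; apply: array_sign_inj => i; rewrite -tensor_codeE -(xi_tensor_sign i h).
by move=> <- i; rewrite (xi_tensor_sign i h) tensor_codeE.
Qed.

Lemma sum_law (f : {ffun multi_index n -> bool} -> R) :
  \sum_v f v * law v = #|signs n|%:R^-1 * \sum_e f (tensor_code e).
Proof.
under eq_bigr do rewrite mulrCA mulr_sumr.
rewrite -mulr_sumr exchange_big; congr (_ * _); apply: eq_bigr => e _ /=.
rewrite (bigD1 (tensor_code e))//= eqxx mulr1 big1 ?addr0// => v.
by rewrite eq_sym => /negbTE ->; rewrite mulr0.
Qed.

Lemma sum_law1 : \sum_v law v = 1.
Proof.
under eq_bigr do rewrite -[law _]mul1r.
by rewrite (sum_law (fun=> 1)) sumr_const -[X in _ * X]mulr_natl mulr1 mulVf.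
Qed.

Variable xi_bar : multi_index n -> {RV P >-> R}.
Hypothesis xi_copy : independent_copy P xi_tensor (fun i => xi_bar i : T -> R).

Lemma prob_code_event_bar w : P (code_event (fun i => xi_bar i) w) = (law w)%:E.
Proof.
have [same _] := xi_copy; rewrite -prob_code_event.
by rewrite (same [set x | forall i, x i = array_sign w i])//;
  exact: (@gen_eq_family R (multi_index n -> R) _ (fun i x => x i) (array_sign w)).
Qed.

(** By independence the two arrays have a product law with equal marginals [law]. A change of
    variables in each argument then replaces the copy by the tensor of a second uniform sign
    vector. *)
Lemma integral_sign_pair (f : T -> R)
    (c : (multi_index n -> R) -> (multi_index n -> R) -> R) :
  measurable_fun setT f -> (forall t, f t = c (xi_tensor^~ t) (fun i => xi_bar i t)) ->
  (\int[P]_t (f t)%:E = ((#|{: signs n * signs n}|%:R)^-1 *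
    \sum_(w : signs n * signs n) c (sign_tensor w.1) (sign_tensor w.2))%:E)%E.
Proof.
move=> mf fc; have [_ indep] := xi_copy.
pose A (vw : {ffun multi_index n -> bool} * {ffun multi_index n -> bool}) :=
  code_event xi_tensor vw.1 `&` code_event (fun i => xi_bar i) vw.2.
rewrite (integral_discrete (A := A) (q := fun vw => law vw.1 * law vw.2)
  (c := fun vw => c (array_sign vw.1) (array_sign vw.2)))//; first congr (_%:E).
- rewrite -(pair_bigA _ (fun v w => c (array_sign v) (array_sign w) * (law v * law w))) /=.
  rewrite -(pair_bigA _ (fun e e' => c (sign_tensor e) (sign_tensor e'))) /=.
  transitivity (\sum_v (\sum_w c (array_sign v) (array_sign w) * law w) * law v).
    apply: eq_bigr => v _; rewrite mulr_suml; apply: eq_bigr => w _.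
    by rewrite -mulrA (mulrC (law v)).
  transitivity (#|signs n|%:R^-1 * \sum_e #|signs n|%:R^-1 *
      \sum_e' c (array_sign (tensor_code e)) (array_sign (tensor_code e'))).
    rewrite (sum_law (fun v => \sum_w c (array_sign v) (array_sign w) * law w)).
    congr (_ * _); apply: eq_bigr => e _.
    exact: (sum_law (fun w => c (array_sign (tensor_code e)) (array_sign w))).
  rewrite -mulr_sumr mulrA -invfM -natrM card_prod; congr (_ * _).
  by apply: eq_bigr => e _; apply: eq_bigr => e' _; congr (c _ _); apply/funext => i;
    rewrite tensor_codeE.
- move=> vw; apply: measurableI; apply: measurable_eq_family => // i.
  exact: measurable_xi_tensor.
- move=> [v w] [v' w'] t [/= hv hw] [/= hv' hw']; congr (_, _); apply: array_sign_inj => i.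
    by rewrite -hv -hv'.
  by rewrite -hw -hw'.
- move=> [v w]; rewrite indep; [|exact: gen_eq_family|exact: gen_eq_family].
  by rewrite prob_code_event prob_code_event_bar EFinM.
- rewrite -(pair_bigA _ (fun v w => law v * law w)) /= -big_distrlr /=.
  by rewrite sum_law1 mulr1.
- by move=> [v w] t [/= hv hw]; rewrite fc; congr (c _ _); apply/funext => i.
Qed.

End RademacherTensor.

(** * Transfer to the probability space *)

Unset Implicit Arguments.
Set Strict Implicit.

Theorem theorem5 (R : realType) (dsp : measure_display) (T : measurableType dsp)
    (P : probability T R) (d : nat) (n : 'I_d -> nat)
    (B : multi_index n -> multi_index n -> R)
    (xi : forall l : 'I_d, 'I_(n l) -> {RV P >-> R})
    (xi_bar : multi_index n -> {RV P >-> R})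
    (p gamma : R)
    (hxi : forall l : 'I_d, rademacher_vector P (fun k => xi l k : T -> R))
    (hindep : mutually_independent P
       (fun l : 'I_d => gen_sigma (fun k => xi l k : T -> R)))
    (hcopy : independent_copy P
       (tensor (fun l k => xi l k : T -> R))
       (fun i => xi_bar i : T -> R))
    (hp : 1 <= p) (hgamma : 0 <= gamma)
    (hdec : forall x : multi_index n -> R, norm2 x = 1 ->
       ('N[P]_(p%:E)[(fun t =>
          (quad_form B x (tensor (fun l k => xi l k : T -> R))
                         (fun i => xi_bar i : T -> R) t)%:E)]
        <= gamma%:E)%E) :
  forall x : multi_index n -> R, norm2 x = 1 ->
    let S := quad_form B x (tensor (fun l k => xi l k : T -> R))
                           (tensor (fun l k => xi l k : T -> R)) in
    ('N[P]_(p%:E)[(fun t => (S t)%:E - 'E_P[S])] <= (5 ^+ d * gamma)%:E)%E.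

Proof.
move=> x x1; cbv zeta; set S := quad_form _ _ _ _.
have mtens := measurable_xi_tensor xi.
have mpow (f : T -> R) : measurable_fun setT f -> measurable_fun setT (fun t => `|f t| `^ p).
  move=> mf; apply: (measurableT_comp (measurable_powR p)).
  exact: measurableT_comp mf.
have mquad (y : multi_index n -> R) (u v : multi_index n -> T -> R) :
    (forall i, measurable_fun setT (u i)) -> (forall i, measurable_fun setT (v i)) ->
    measurable_fun setT (quad_form B y u v).
  move=> mu mv; apply: measurable_sum => i; apply: measurable_sum => i'.
  by apply: measurable_funM => //; apply: measurable_funM.
(* The hypothesis, restated for a uniform pair of sign vectors. *)
have decoupled_le (y : multi_index n -> R) : norm2 y = 1 ->
    Lp_le p (fun w : signs n * signs n =>
      bilinear B y (sign_tensor w.1) (sign_tensor w.2)) gamma.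
  move=> /hdec.
  rewrite (Lnorm_le (M := #|{: signs n * signs n}|%:R^-1 * \sum_(w : signs n * signs n)
    `|bilinear B y (sign_tensor w.1) (sign_tensor w.2)| `^ p))//.
  - move=> h; split=> //; move: h; rewrite -ler_pdivlMl ?invrK// invr_gt0 ltr0n.
    by apply/card_gt0P; exists ([ffun=> true], [ffun=> true]).
  - by rewrite mulr_ge0 ?invr_ge0// sumr_ge0// => w _; exact: powR_ge0.
  - apply: (integral_sign_pair hxi hindep hcopy (c := fun u v => `|bilinear B y u v| `^ p)) => //.
    by apply/mpow/mquad => // i; exact: measurable_funPT.
have mS : measurable_fun setT S by exact: mquad.
have S_sign e t : (forall l j, xi l j t = sg e j) ->
    S t = bilinear B x (sign_tensor e) (sign_tensor e).
  by move=> h; apply: eq_bigr => i _; apply: eq_bigr => i' _; rewrite !(xi_tensor_sign _ h).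
have cs0 : 0 < #|signs n|%:R :> R.
  by rewrite ltr0n; apply/card_gt0P; exists [ffun=> true].
have ES : ('E_P[S] = (\sum_i B i i * x i ^+ 2)%:E)%E.
  rewrite unlock (integral_sign hxi hindep mS S_sign) sum_bilinear_sign.
  by rewrite mulKf// gt_eqF.
rewrite ES.
have [c0 le_c] := decoupling_le hp decoupled_le x1.
(* The conclusion likewise becomes a moment bound under one uniform sign vector. *)
rewrite (Lnorm_le (f := fun t => S t - \sum_i B i i * x i ^+ 2)
  (M := #|signs n|%:R^-1 * \sum_(m : signs n)
    `|bilinear B x (sign_tensor m) (sign_tensor m) - \sum_i B i i * x i ^+ 2| `^ p))//.
- by rewrite ler_pdivrMl.
- by rewrite mulr_ge0 ?invr_ge0// sumr_ge0// => w _; exact: powR_ge0.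
- apply: integral_sign => //; last by move=> e t /S_sign ->.
  by apply/mpow/measurable_funB.
Qed.
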